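(* Let $1 \leq k \leq n$. Let $\Psi \colon \mathbb{R}^{2n} \to \mathbb{R}^{2n}$ be an affine map of the form $z \mapsto Az + b$, where $A$ is a linear map preserving $\omega^k$ (that is, $A^*(\omega^k) = \omega^k$) and $b \in \mathbb{R}^{2n}$. If $\Psi(B(r)) \subseteq Z_k(R)$, then $r \leq R$.
   Context: $\mathbb{R}^{2n}$ has coordinates $(x_1,\dots,x_n,y_1,\dots,y_n)$, the standard Euclidean metric and the standard symplectic form $\omega = dx^1\wedge dy^1 + \cdots + dx^n\wedge dy^n$; $\omega^k$ denotes the $k$-fold wedge power of $\omega$. $r, R > 0$ are real numbers, $B(r)$ is the closed ball of radius $r$ centered at the origin in $\mathbb{R}^{2n}$, and $Z_k(R) = \{(x_1,\dots,x_n,y_1,\dots,y_n)\in\mathbb{R}^{2n} : \sum_{j=1}^k (x_j^2+y_j^2) \leq R^2\}$. *)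

(* Defs.v *)
From HB Require Import structures.
From mathcomp Require Import all_boot all_order all_algebra all_fingroup.
From mathcomp Require Import boolp classical_sets reals.

Set Implicit Arguments.
Unset Strict Implicit.
Unset Printing Implicit Defensive.

Import Order.TTheory GRing.Theory Num.Theory.
Local Open Scope ring_scope.

(* The carrier 'rV[F]_(n + n) is R^{2n}, with x_j at index lshift n j and y_j
   at index rshift n j. *)
Section Forms.
Variables (F : realType) (V : lmodType F).

(* Alternation and multilinearity are not bundled: the forms used here (the
   coordinate 1-forms and what wedge makes of them) have both properties. *)
Definition form (p : nat) : Type := ('I_p -> V) -> F.

(* The determinant normalization, in which
   (a /\ b)(u, v) = a u * b v - a v * b u for 1-forms a and b. *)
Definition wedge (p q : nat) (a : form p) (b : form q) : form (p + q) :=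
  fun v => ((p`! * q`!)%:R)^-1 *
    \sum_(s : 'S_(p + q))
      (-1) ^+ s * a (fun i => v (s (lshift q i)))
                * b (fun j => v (s (rshift p j))).

(* The degree k.+1 * p is convertible to p + k * p, so no cast is needed. *)
Fixpoint wedge_pow (p : nat) (a : form p) (k : nat) : form (k * p) :=
  match k return form (k * p) with
  | 0 => fun _ => 1
  | k'.+1 => wedge a (@wedge_pow p a k')
  end.

Definition pullback (A : {linear V -> V}) (p : nat) (a : form p) : form p :=
  fun v => a (fun i => A (v i)).

End Forms.

Arguments wedge_pow {F V p} a k _.

Section Symplectic.
Variables (F : realType) (n : nat).

Definition xcoord (j : 'I_n) (z : 'rV[F]_(n + n)) : F := z ord0 (lshift n j).
Definition ycoord (j : 'I_n) (z : 'rV[F]_(n + n)) : F := z ord0 (rshift n j).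

Definition dx (j : 'I_n) : form 'rV[F]_(n + n) 1 := fun v => xcoord j (v ord0).
Definition dy (j : 'I_n) : form 'rV[F]_(n + n) 1 := fun v => ycoord j (v ord0).

Definition omega : form 'rV[F]_(n + n) 2 :=
  fun v => \sum_(j < n) wedge (dx j) (dy j) v.

(* The library's `|z| on row vectors is the sup norm, hence this definition. *)
Definition enorm (z : 'rV[F]_(n + n)) : F :=
  Num.sqrt (\sum_(i < n + n) z ord0 i ^+ 2).

Definition cball (r : F) : set 'rV[F]_(n + n) := [set z | enorm z <= r]%classic.

Definition cylinder (k : nat) (R : F) : set 'rV[F]_(n + n) :=
  [set z | \sum_(j < n | (j < k)%N) (xcoord j z ^+ 2 + ycoord j z ^+ 2)
           <= R ^+ 2]%classic.

End Symplectic.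

Arguments omega F n : clear implicits.
Arguments cball {F} n r.
Arguments cylinder {F} n k R.

(* Main.v *)
Require Import Defs.
From HB Require Import structures.
From mathcomp Require Import all_boot all_order all_algebra all_fingroup.
From mathcomp Require Import boolp classical_sets reals.
From mathcomp Require Import ring lra zify.

Set Implicit Arguments.
Unset Strict Implicit.
Unset Printing Implicit Defensive.

Import Order.TTheory GRing.Theory Num.Theory.
Local Open Scope ring_scope.
Local Open Scope classical_set_scope.

(** Write [w] for the standard symplectic form and [t] for [(R / r) ^+ 2].
    Comparing the images of [z] and [- z] removes the translation [b], and
    homogeneity turns the inclusion into an estimate valid for every [z]: the
    squared norm of the first [k] planes of [A z] is at most [t] times the
    squared norm of [z] (cylsq_contract).  What remains is [1 <= t].  Throughout,
    [w ^ k] is positive on the Darboux tuples [e_1, f_1, .., e_k, f_k]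
    (wedge_pow_darboux_gram_gt0).

    If [k < n], then [w' = A^* w] equals [c w] with [c ^+ k = 1].  To see that
    [w'] vanishes on two members [u], [x] of different planes of a Darboux frame,
    suppose that [w' (u, x) <> 0].  Adding multiples of [x] to the vectors of the
    other planes does not change their [w]-products, and it can make all of them
    [w']-orthogonal to [u]; there are [n - 1 >= k] such planes, so [w ^ k] is
    positive on a tuple that contains [u], whereas [w' ^ k] is zero on it
    (darboux_frame_cross).  Applying this to a sheared frame as well shows that
    the proportionality factors on two planes agree (darboux_frame_conformal).
    Hence the transpose of [A] also multiplies [w] by [c]; the first two vectors
    of its image frame have [w]-product of modulus 1, while each of them has
    squared norm at most [t].  As [|w (u, v)|] is at most the half sum of the
    squared norms, [1 <= t] (linear_squeezing_lt).

    If [k = n], the form [w ^ n] only controls the volume, and the cylinder is a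
    ball, so that [A] itself contracts when [t < 1].  The powers of [A] then send
    a Darboux frame to tuples tending to 0, on which [w ^ n] tends to 0 although
    it keeps a constant positive value (linear_squeezing_eq). *)

(** * Wedge powers of a form *)

Lemma wedge_perm (F : realType) (V : lmodType F) p q (a : Defs.form V p)
    (b : Defs.form V q) (v : 'I_(p + q) -> V) (t : 'S_(p + q)) :
  wedge a b (fun i => v (t i)) = (-1) ^+ t * wedge a b v.
Proof.
rewrite /wedge [RHS]mulrCA; congr (_ * _).
rewrite mulr_sumr [RHS](reindex_inj (mulIg t)) /=.
apply: eq_bigr => s _; rewrite odd_permM signr_addb !mulrA.
rewrite [(-1) ^+ t * _]mulrC -[_ * _ * (-1) ^+ t]mulrA -signr_addb addbb mulr1.
by congr (_ * a _ * b _); apply/funext => i; rewrite permM.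
Qed.

Lemma wedge_pow_perm (F : realType) (V : lmodType F) p (a : Defs.form V p) k
    (v : 'I_(k * p) -> V) (t : 'S_(k * p)) :
  wedge_pow a k (fun i => v (t i)) = (-1) ^+ t * wedge_pow a k v.
Proof.
case: k v t => [|k] v t; last exact: wedge_perm.
by rewrite (permS0 t) odd_perm1 mulr1.
Qed.

(** Since [a] is only evaluated on members of the tuple, this covers both
    rescaling the form and pulling it back; asking for the values on all
    reindexed subtuples lets the induction pass through the permutations. *)
Lemma wedge_pow_scale (F : realType) (V V' : lmodType F) p (c : F)
    (a : Defs.form V p) (a' : Defs.form V' p) k
    (v : 'I_(k * p) -> V) (v' : 'I_(k * p) -> V') :
    (forall f : 'I_p -> 'I_(k * p),
       a (fun i => v (f i)) = c * a' (fun i => v' (f i))) ->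
  wedge_pow a k v = c ^+ k * wedge_pow a' k v'.
Proof.
elim: k v v' => [|k IHk] v v' aE /=; first by rewrite mulr1.
rewrite /wedge [RHS]mulrCA; congr (_ * _); rewrite mulr_sumr.
apply: eq_bigr => s _; rewrite aE (IHk _ (fun j => v' (s (rshift p j)))).
  by rewrite exprS [_ * (c * _)]mulrCA mulrACA.
by move=> f; rewrite aE.
Qed.

(** A vector of the tuple on which every value of [a] vanishes enters each term
    of the expanded power exactly once, so all the terms are zero. *)
Lemma wedge_pow_radical (F : realType) (V : lmodType F) p (a : Defs.form V p) k
    (v : 'I_(k * p) -> V) (i0 : 'I_(k * p)) :
    (forall f : 'I_p -> 'I_(k * p), (exists i, f i = i0) ->
       a (fun i => v (f i)) = 0) ->
  wedge_pow a k v = 0.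
Proof.
elim: k v i0 => [|k IHk] v i0 a0 /=; first by case: i0 a0.
rewrite /wedge big1 ?mulr0 // => s _.
case: (split_ordP (s^-1%g i0)) => j jE.
- rewrite (a0 (fun i => s (lshift _ i))) ?mulr0 ?mul0r //.
  by exists j; rewrite -jE permKV.
- rewrite (IHk _ j) ?mulr0 // => f [i fi].
  by apply: a0 (fun i => s (rshift p (f i))) _; exists i; rewrite fi -jE permKV.
Qed.

(** A quantitative continuity of the power at 0, with a constant that does not
    depend on the tuple. *)
Lemma wedge_pow_bound (F : realType) (V : lmodType F) p (a : Defs.form V p) k :
  exists2 C : F, 0 <= C & forall (eps : F) (v : 'I_(k * p) -> V), 0 <= eps ->
    (forall f : 'I_p -> 'I_(k * p), `|a (fun i => v (f i))| <= eps) ->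
  `|wedge_pow a k v| <= C * eps ^+ k.
Proof.
elim: k => [|k [C C0 IHk]].
  by exists 1 => // eps v _ _ /=; rewrite normr1 mulr1.
exists (((p`! * (k * p)`!)%:R)^-1 * \sum_(s : 'S_(p + k * p)) C).
  by rewrite mulr_ge0 ?invr_ge0 ?ler0n // sumr_ge0.
move=> eps v eps0 av /=; rewrite /wedge normrM ger0_norm ?invr_ge0 ?ler0n //.
rewrite -mulrA ler_wpM2l ?invr_ge0 ?ler0n // mulr_suml.
apply: le_trans (ler_norm_sum _ _ _) _; apply: ler_sum => s _.
rewrite !normrM normr_sign mul1r exprS mulrCA.
apply: ler_pM => //.
by apply: IHk => // f; apply: av (fun i => s (rshift p (f i))).
Qed.

(** * Positivity on Darboux tuples *)

(** The Gram matrix of a tuple [e_1, f_1, e_2, f_2, ..] of pairs with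
    [w (e_i, f_i) = 1] in which distinct pairs are orthogonal. *)
Definition darboux_gram (F : realType) (x y : nat) : F :=
  (x./2 == y./2)%:R * ((odd y)%:R - (odd x)%:R).

Lemma perm_fix0 n (s : 'S_n.+1) : s ord0 = ord0 ->
  exists t : 'S_n, s = lift_perm ord0 ord0 t.
Proof.
move=> s0.
have sl i : exists j, s (lift ord0 i) = lift ord0 j.
  have : ord0 != s (lift ord0 i).
    by rewrite -[X in X != _]s0 (inj_eq perm_inj) neq_lift.
  by case/unlift_some => j -> _; exists j.
have [f fE] := choice sl.
have finj : injective f.
  move=> i j fij; apply: (@lift_inj _ ord0); apply: (@perm_inj _ s).
  by rewrite !fE fij.
exists (perm finj); apply/permP => i.
case: (unliftP ord0 i) => [j|] ->; first by rewrite lift_perm_lift permE fE.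
by rewrite lift_perm_id.
Qed.

Lemma val_tperm N (a b x : 'I_N) : (tperm a b x : nat) =
  if x == a :> nat then b : nat else if x == b :> nat then a : nat else x.
Proof. by rewrite permE /= !(inj_eq val_inj); do 2 case: ifP => //. Qed.

Lemma tperm2E N (o0 o1 e o x : 'I_N) : o0 = 0%N :> nat -> o1 = 1%N :> nat ->
    odd e = false -> odd o -> e./2 = o./2 ->
  nat_of_ord ((tperm o0 e * tperm o1 o)%g x) =
    if x == 0%N :> nat then e : nat else if x == 1%N :> nat then o : nat
    else if x == e :> nat then 0%N else if x == o :> nat then 1%N else x.
Proof.
move=> /= v0 v1 ee oo eo; rewrite permM !val_tperm v0 v1.
case: (x =P 0%N :> nat) => ?; case: (x =P e :> nat) => ?;
  do ?[case: eqP => ?]; lia.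
Qed.

Lemma darboux_gram_tperm2 (F : realType) N (o0 o1 e o x y : 'I_N) :
    o0 = 0%N :> nat -> o1 = 1%N :> nat ->
    odd e = false -> odd o -> e./2 = o./2 -> (1 < x)%N -> (1 < y)%N ->
  let t := (tperm o0 e * tperm o1 o)%g in
  darboux_gram F (t x) (t y) = darboux_gram F x y.
Proof.
move=> v0 v1 ee oo eo x1 y1 t.
have tE (z : 'I_N) : (1 < z)%N -> (odd (t z) = odd z) /\
     (t z : nat)./2 = if z./2 == e./2 then 0%N else z./2.
  move=> z1; rewrite tperm2E //; do ?[case: eqP => ?]; split; lia.
rewrite /darboux_gram; have [-> ->] := tE _ x1; have [-> ->] := tE _ y1.
congr (_%:R * _); congr nat_of_bool.
do ?[case: (_ =P e./2) => ?]; lia.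
Qed.

Lemma darboux_gramC (F : realType) x y : darboux_gram F y x = - darboux_gram F x y.
Proof. by rewrite /darboux_gram eq_sym -mulrN opprB. Qed.

(** The correction by [(-1) ^+ t] expresses that swapping two pairs is an even
    permutation, so the only sign left is the orientation of the pair (i, j). *)
Lemma pair_perm (F : realType) N (o0 o1 i j : 'I_N) :
    o0 = 0%N :> nat -> o1 = 1%N :> nat -> i./2 = j./2 -> odd i = ~~ odd j ->
  exists t : 'S_N, [/\ t o0 = i, t o1 = j, (-1) ^+ t * darboux_gram F i j = 1 &
    forall x y : 'I_N, (1 < x)%N -> (1 < y)%N ->
      darboux_gram F (t x) (t y) = darboux_gram F x y].
Proof.
move=> v0 v1; wlog ei : i j / odd i = false => [base|] eqh oij.
  case oi : (odd i); last exact: base.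
  have [||t [t0 t1 ts tD]] := base j i _ (esym eqh); first by lia.
    by rewrite oij negbK.
  have o01 : o0 != o1 by rewrite -(inj_eq val_inj) /= v0 v1.
  exists (tperm o0 o1 * t)%g; split.
  - by rewrite permM tpermL.
  - by rewrite permM tpermR.
  - by rewrite odd_mul_tperm o01 signrN mulNr darboux_gramC mulrN opprK.
  - have tE (z : 'I_N) : (1 < z)%N -> (tperm o0 o1 * t)%g z = t z.
      by move=> z1; rewrite permM tpermD // -(inj_eq val_inj) /= ?v0 ?v1; lia.
    by move=> x y x1 y1; rewrite !tE ?tD.
have oj : odd j by move: oij; rewrite ei; case: odd.
exists (tperm o0 i * tperm o1 j)%g; split.
- by apply/val_inj; rewrite /= tperm2E // v0.
- by apply/val_inj; rewrite /= tperm2E // v1.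
- rewrite odd_mul_tperm odd_tperm.
  have -> : (o1 != j) = (o0 != i).
    by rewrite -!(inj_eq val_inj) /= v0 v1; congr (~~ _); lia.
  by rewrite addbb mul1r /darboux_gram eqh eqxx mul1r ei oj subr0.
- by move=> x y; apply: darboux_gram_tperm2.
Qed.

(** In the expansion of the power, the term of a permutation is zero unless it
    sends the first two positions to one pair, and positive in that case: up to an
    even permutation of the pairs the pair is the first one; its orientation enters both
    the signature and the value of [a], and reordering the remaining vectors changes
    both the signature and the lower power by the same sign. *)
Lemma wedge_pow_darboux_gram_gt0 (F : realType) (V : lmodType F) (a : Defs.form V 2) k
    (v : 'I_(k * 2) -> V) :
    (forall f : 'I_2 -> 'I_(k * 2),
       a (fun i => v (f i)) = darboux_gram F (f ord0) (f ord_max)) ->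
  0 < wedge_pow a k v.
Proof.
elim: k v => [|k IHk] v aE /=; first exact: ltr01.
rewrite /wedge mulr_gt0 ?invr_gt0 ?ltr0n ?muln_gt0 ?fact_gt0 //.
pose o0 : 'I_(2 + k * 2) := lshift _ ord0.
pose o1 : 'I_(2 + k * 2) := lshift _ ord_max.
have term_gt0 (s t : 'S_(2 + k * 2)) : s o0 = t o0 -> s o1 = t o1 ->
   (forall x y : 'I_(k * 2),
      darboux_gram F (t (rshift 2 x)) (t (rshift 2 y)) = darboux_gram F x y) ->
   (-1) ^+ t * darboux_gram F (t o0) (t o1) = 1 ->
   0 < (-1) ^+ s * a (fun i => v (s (lshift _ i)))
       * wedge_pow a k (fun j => v (s (rshift 2 j))).
  move=> s0 s1 tD t1.
  (* s' fixes the first two positions, so it comes from a permutation w of the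
     other ones. *)
  pose s' := (s * t^-1)%g.
  have s'0 : s' ord0 = ord0.
    rewrite permM (_ : ord0 = o0) ?s0 ?permK //; exact: val_inj.
  have [u uE] := perm_fix0 s'0.
  have u0 : u ord0 = ord0.
    apply: (@lift_inj _ ord0); rewrite -(lift_perm_lift ord0 ord0) -uE permM.
    rewrite (_ : lift _ _ = o1) ?s1 ?permK //; exact: val_inj.
  have [w wE] := perm_fix0 u0.
  have sE : s = (s' * t)%g by rewrite mulgKV.
  have sr j : s (rshift 2 j) = t (rshift 2 (w j)).
    have rE x : rshift 2 x = lift ord0 (lift ord0 x) by exact: val_inj.
    by rewrite sE permM !rE uE lift_perm_lift wE lift_perm_lift.
  rewrite (_ : (fun j => _) = fun j => v (t (rshift 2 (w j)))); last first.
    by apply/funext => j; rewrite sr.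
  rewrite (wedge_pow_perm a (fun j => v (t (rshift 2 j)))).
  rewrite (aE (fun i => s (lshift _ i))) -/o0 -/o1 s0 s1.
  have -> : (-1) ^+ s = (-1) ^+ w * (-1) ^+ t :> F.
    by rewrite -signr_addb sE odd_permM uE odd_lift_perm wE odd_lift_perm.
  set d := darboux_gram _ _ _; set W := wedge_pow _ _ _.
  rewrite -[_ * _ * d]mulrA mulrACA mulrA.
  rewrite -signr_addb addbb t1 !mul1r; apply: IHk => f.
  by rewrite (aE (fun i => t (rshift 2 (f i)))) tD.
rewrite (bigD1 1%g) //= ltr_pwDl //.
  apply: (term_gt0 1%g 1%g) => //.
    by move=> x y; rewrite !perm1 /darboux_gram /= !negbK eqSS.
  by rewrite odd_perm1 !perm1 /darboux_gram /= !mul1r subr0.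
apply: sumr_ge0 => s _.
have [e0|ne0] := eqVneq (darboux_gram F (s o0) (s o1)) 0.
  by rewrite (aE (fun i => s (lshift _ i))) -/o0 -/o1 e0 mulr0 mul0r.
apply/ltW.
move: ne0; rewrite /darboux_gram mulf_eq0 negb_or pnatr_eq0 eqb0 negbK => /andP[/eqP hh].
rewrite subr_eq0 => odne.
have {}odne : odd (s o0) = ~~ odd (s o1).
  by move: odne; do 2 case: (odd _) => //; rewrite eqxx.
have [t [t0 t1 ts tD]] := pair_perm F (erefl : o0 = 0%N :> nat)
  (erefl : o1 = 1%N :> nat) hh odne.
apply: (term_gt0 s t); rewrite ?t0 ?t1 // => x y.
by rewrite tD //= /darboux_gram /= !negbK eqSS.
Qed.

(** * Forms of skew-symmetric matrices and Darboux frames *)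

Definition bform (F : realType) N (S : 'M[F]_N) (u w : 'rV[F]_N) : F :=
  (u *m S *m w^T) ord0 ord0.

Definition form_of_mx (F : realType) N (S : 'M[F]_N) : Defs.form 'rV[F]_N 2 :=
  fun v => bform S (v ord0) (v ord_max).

Lemma bformDl (F : realType) N (S : 'M[F]_N) u u' w :
  bform S (u + u') w = bform S u w + bform S u' w.
Proof. by rewrite /bform !mulmxDl mxE. Qed.

Lemma bformZl (F : realType) N (S : 'M[F]_N) c u w :
  bform S (c *: u) w = c * bform S u w.
Proof. by rewrite /bform -!scalemxAl mxE. Qed.

Lemma bform_skew (F : realType) N (S : 'M[F]_N) u w : S^T = - S ->
  bform S w u = - bform S u w.
Proof.
move=> SN; rewrite /bform; transitivity ((w *m S *m u^T)^T ord0 ord0).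
  by rewrite [RHS]mxE.
by rewrite !trmx_mul trmxK SN mulNmx mulmxN mxE mulmxA.
Qed.

Lemma bformDr (F : realType) N (S : 'M[F]_N) u w w' :
  bform S u (w + w') = bform S u w + bform S u w'.
Proof. by rewrite /bform linearD /= mulmxDr mxE. Qed.

Lemma bformZr (F : realType) N (S : 'M[F]_N) c u w :
  bform S u (c *: w) = c * bform S u w.
Proof. by rewrite /bform linearZ /= -scalemxAr mxE. Qed.

Lemma bform_diag (F : realType) N (S : 'M[F]_N) u : S^T = - S ->
  bform S u u = 0.
Proof. by move=> /(bform_skew u u); lra. Qed.

(** The vectors [e i false] and [e i true] are the two members of the i-th pair;
    the difference of the booleans is the sign of their product. *)
Definition darboux_frame (F : realType) N (S : 'M[F]_N) n
    (e : 'I_n -> bool -> 'rV[F]_N) :=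
  forall i j s t, bform S (e i s) (e j t) = (i == j)%:R * (t%:R - s%:R).

Lemma half_ord_lt k (x : 'I_(k * 2)) : (x./2 < k)%N.
Proof. by have := ltn_ord x; lia. Qed.

Definition darboux_frame_tuple (T : Type) k (e : 'I_k -> bool -> T)
    (x : 'I_(k * 2)) :=
  e (Ordinal (half_ord_lt x)) (odd x).

Lemma wedge_pow_darboux_frame_gt0 (F : realType) N (S : 'M[F]_N) k
    (e : 'I_k -> bool -> 'rV[F]_N) : darboux_frame S e ->
  0 < wedge_pow (form_of_mx S) k (darboux_frame_tuple e).
Proof.
move=> eS; apply: wedge_pow_darboux_gram_gt0 => f.
by rewrite /form_of_mx /darboux_frame_tuple eS /darboux_gram -(inj_eq val_inj).
Qed.

Lemma darboux_frame_inj (F : realType) N (S : 'M[F]_N) n k (h : 'I_k -> 'I_n)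
    (e : 'I_n -> bool -> 'rV[F]_N) : injective h ->
  darboux_frame S e -> darboux_frame S (fun i => e (h i)).
Proof. by move=> hinj eS i j s t; rewrite eS (inj_eq hinj). Qed.

Lemma inj_avoid n k (i m : 'I_n) : i != m -> (k.+1 < n)%N ->
  exists h : 'I_k.+1 -> 'I_n,
    [/\ injective h, h ord0 = i & forall j, h j != m].
Proof.
move=> im kn.
have n0 : (0 < n)%N by lia.
have nl : (n.-1 < n)%N by lia.
pose o0 := Ordinal n0; pose ol := Ordinal nl.
have o0l : ol != o0 by rewrite -(inj_eq val_inj) /=; lia.
(* s sends the first index to i and the last one, which is beyond k, to m. *)
pose s := (tperm o0 i * tperm (tperm o0 i ol) m)%g.
have s0 : s o0 = i.
  rewrite permM tpermL tpermD //; last by rewrite eq_sym.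
  by rewrite -[X in _ != X](tpermL o0) (inj_eq perm_inj).
have sl : s ol = m by rewrite permM tpermL.
exists (fun j => s (widen_ord (ltnW kn) j)); split.
- by move=> x y /perm_inj /(congr1 val) /= /val_inj.
- by rewrite -[RHS]s0; congr (s _); apply: val_inj.
- move=> j; rewrite -sl (inj_eq perm_inj) -(inj_eq val_inj) /=.
  by have := ltn_ord j; lia.
Qed.

(** If the product [c] of the two vectors were nonzero, subtracting multiples of
    [e m t] from the pairs other than the m-th would keep them a Darboux frame for
    [S] and would put [e i s] in the [S']-radical of the resulting tuple. *)
Lemma darboux_frame_cross (F : realType) N (S S' : 'M[F]_N) n k
    (e : 'I_n -> bool -> 'rV[F]_N) i m s t :
    S^T = - S -> S'^T = - S' -> (0 < k < n)%N ->
    wedge_pow (form_of_mx S) k = wedge_pow (form_of_mx S') k -> darboux_frame S e ->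
    i != m ->
  bform S' (e i s) (e m t) = 0.
Proof.
case: k => // k SN S'N kn eqw eS im; apply/eqP/negP => /negP c0.
set c := bform _ _ _ in c0.
have [h [hinj h0 hm]] := inj_avoid im kn.
pose a j s' := bform S' (e i s) (e (h j) s') / c.
pose e' j s' := e (h j) s' - a j s' *: e m t.
have e'S : darboux_frame S e'.
  move=> j l s1 s2; rewrite /e' -!scaleNr !bformDl !bformDr !bformZl !bformZr.
  rewrite !eS eqxx (negPf (hm j)) [m == _]eq_sym (negPf (hm l)) (inj_eq hinj).
  rewrite /=; ring.
have ort j s' : bform S' (e i s) (e' j s') = 0.
  by rewrite /e' -scaleNr bformDr bformZr -/c mulNr divfK // subrr.
have e'0 : e' ord0 s = e i s.
  by rewrite /e' /a h0 bform_diag // mul0r scale0r subr0.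
suff w0 : wedge_pow (form_of_mx S') k.+1 (darboux_frame_tuple e') = 0.
  by have := wedge_pow_darboux_frame_gt0 e'S; rewrite eqw w0 ltxx.
have sk : (s < k.+1 * 2)%N by case: (s); lia.
have xE : darboux_frame_tuple e' (Ordinal sk) = e i s.
  rewrite -e'0 /darboux_frame_tuple /=; congr (e' _ _); first apply/val_inj => /=;
  by case: (s).
apply: (wedge_pow_radical (i0 := Ordinal sk)) => f [x fx].
rewrite /form_of_mx.
have [x0|x1] : x = ord0 \/ x = ord_max.
  by case: x {fx} => -[|[|]] // ?; [left|right]; apply: val_inj.
- by rewrite -x0 fx xE /darboux_frame_tuple ort.
- by rewrite -x1 fx xE bform_skew // /darboux_frame_tuple ort oppr0.
Qed.

(** The symplectic shear that replaces [e_i] by [e_i + e_m] and [f_m] by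
    [f_m - f_i]. *)
Lemma darboux_frame_shear (F : realType) N (S : 'M[F]_N) n
    (e : 'I_n -> bool -> 'rV[F]_N) i m : S^T = - S -> darboux_frame S e -> i != m ->
  darboux_frame S (fun j s => e j s + ((j == i) && ~~ s)%:R *: e m false
                            - ((j == m) && s)%:R *: e i true).
Proof.
move=> SN eS im j l s t.
rewrite -!scaleNr !bformDl !bformDr !bformZl !bformZr !eS.
rewrite (negPf im) [m == i]eq_sym (negPf im) !eqxx [i == l]eq_sym [m == l]eq_sym.
case: (eqVneq j i) => [->|ji]; case: (eqVneq l i) => [->|li];
 rewrite ?eqxx ?(negPf im) ?(negPf ji) ?(negPf li);
 case: s; case: t; rewrite /= ?andbT ?andbF /=; ring.
Qed.

(** Orthogonality of different pairs makes [S'] a multiple of [S] on each pair;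
    that of [e_i + e_m] and [f_m - f_i], which belong to different pairs of the
    sheared frame, says that the multiples agree. *)
Lemma darboux_frame_conformal (F : realType) N (S S' : 'M[F]_N) n k
    (e : 'I_n -> bool -> 'rV[F]_N) :
    S^T = - S -> S'^T = - S' -> (0 < k < n)%N ->
    wedge_pow (form_of_mx S) k = wedge_pow (form_of_mx S') k -> darboux_frame S e ->
  exists2 c, c ^+ k = 1 &
    forall i j s t, bform S' (e i s) (e j t) = c * bform S (e i s) (e j t).
Proof.
move=> SN S'N kn eqw eS.
have n0 : (0 < n)%N by lia.
pose c i := bform S' (e i false) (e i true).
have cE i m : c i = c m.
  have [->//|im] := eqVneq i m.
  have cross := darboux_frame_cross _ _ SN S'N kn eqw.
  have := cross _ _ _ false true (darboux_frame_shear SN eS im) im.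
  rewrite /= !eqxx (negPf im) [m == i]eq_sym (negPf im) /=.
  rewrite !scale1r !scale0r !addr0 subr0 -scaleN1r !bformDl !bformDr !bformZr.
  rewrite -/(c i) -/(c m) !(cross _ _ _ _ _ eS) //; last by rewrite eq_sym.
  by lra.
pose c0 := c (Ordinal n0).
have SE i j s t : bform S' (e i s) (e j t) = c0 * bform S (e i s) (e j t).
  rewrite eS; have [->|ij] := eqVneq i j; last first.
    by rewrite (darboux_frame_cross _ _ SN S'N kn eqw eS ij) /= mul0r mulr0.
  rewrite /= mul1r /c0 (cE _ j).
  case: s; case: t; rewrite /= ?subrr ?mulr0 ?bform_diag //.
    by rewrite (bform_skew _ _ S'N) sub0r mulrN mulr1.
  by rewrite subr0 mulr1.
exists c0 => //.
have kn' : (k <= n)%N by lia.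
pose v := darboux_frame_tuple (fun i : 'I_k => e (widen_ord kn' i)).
have eS' : darboux_frame S (fun i : 'I_k => e (widen_ord kn' i)).
  by apply: darboux_frame_inj eS => x y /(congr1 val) /= /val_inj.
have := wedge_pow_darboux_frame_gt0 eS'; rewrite -/v => v0.
have : wedge_pow (form_of_mx S') k v = c0 ^+ k * wedge_pow (form_of_mx S) k v.
  by apply: wedge_pow_scale => f; rewrite /form_of_mx /v /darboux_frame_tuple SE.
rewrite -eqw -[LHS]mul1r => /mulIf -> //; exact: lt0r_neq0.
Qed.


(** * The standard symplectic form *)

Definition Jmx (F : realType) n : 'M[F]_(n + n) := block_mx 0 1%:M (- 1%:M) 0.

Lemma trmx_Jmx (F : realType) n : (Jmx F n)^T = - Jmx F n.
Proof.
by rewrite /Jmx tr_block_mx opp_block_mx !trmx0 linearN /= !trmx1 !oppr0 opprK.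
Qed.

Lemma mulJJ (F : realType) n : Jmx F n *m Jmx F n = - 1%:M.
Proof.
rewrite /Jmx mulmx_block !mul0mx !mulmx0 !mulmx1 !mul1mx !addr0 !add0r.
by rewrite -oppr0 -opp_block_mx -scalar_mx_block.
Qed.

Lemma bform_JmxE (F : realType) n (u w : 'rV[F]_(n + n)) :
  bform (Jmx F n) u w =
    \sum_(j < n) (xcoord j u * ycoord j w - ycoord j u * xcoord j w).
Proof.
rewrite /bform -{1}[u]hsubmxK -{1}[w]hsubmxK tr_row_mx mul_row_block mul_row_col.
rewrite !mulmx0 mulmxN !mulmx1 add0r addr0 mulNmx !mxE addrC -sumrB.
by apply: eq_bigr => j _; rewrite !mxE.
Qed.

(** The sum over the permutations of two elements is the Leibniz formula of a
    determinant of order 2. *)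
Lemma wedge11 (F : realType) (V : lmodType F) (a b : V -> F) (v : 'I_(1 + 1) -> V) :
  wedge (fun u : 'I_1 -> V => a (u ord0)) (fun u : 'I_1 -> V => b (u ord0)) v
  = a (v ord0) * b (v ord_max) - b (v ord0) * a (v ord_max).
Proof.
pose M : 'M[F]_2 := \matrix_(i, j) if i == ord0 then a (v j) else b (v j).
transitivity (\det M).
  rewrite /wedge (_ : (1`! * 1`!)%N = 1%N) // invr1 mul1r; apply: eq_bigr => s _.
  rewrite -mulrA; congr (_ * _); rewrite !big_ord_recl big_ord0 mulr1 !mxE /=.
  by congr (a (v (s _)) * b (v (s _))); apply: val_inj.
rewrite (expand_det_row _ ord0) !big_ord_recl big_ord0 addr0 /cofactor !det_mx11.
rewrite !mxE /= expr0 mul1r expr1 mulN1r mulrN [in X in _ - X]mulrC.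
by congr (a (v _) * b (v _) - b (v _) * a (v _)); apply: val_inj.
Qed.

Lemma omega_form_of_mx (F : realType) n : omega F n = form_of_mx (Jmx F n).
Proof.
apply/funext => v; rewrite /form_of_mx bform_JmxE; apply: eq_bigr => j _.
by rewrite /dx /dy wedge11.
Qed.

Definition std_frame (F : realType) n (i : 'I_n) (s : bool) : 'rV[F]_(n + n) :=
  delta_mx ord0 (if s then rshift n i else lshift n i).

Lemma bform_delta (F : realType) N (S : 'M[F]_N) i j :
  bform S (delta_mx ord0 i) (delta_mx ord0 j) = S i j.
Proof. by rewrite /bform -rowE trmx_delta -colE !mxE. Qed.

Lemma std_frame_darboux (F : realType) n : darboux_frame (Jmx F n) (@std_frame F n).
Proof.
move=> i j s t; rewrite /std_frame bform_delta /Jmx.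
case: s; case: t;
 rewrite ?(block_mxEul, block_mxEur, block_mxEdl, block_mxEdr) !mxE /=.
- by rewrite subrr mulr0.
- by rewrite sub0r mulrN mulr1.
- by rewrite subr0 mulr1.
- by rewrite subrr mulr0.
Qed.

(** * Norm estimates *)

Definition sqn (F : realType) N (z : 'rV[F]_N) : F := \sum_i z ord0 i ^+ 2.

Lemma sqn_ge0 (F : realType) N (z : 'rV[F]_N) : 0 <= sqn z.
Proof. by apply: sumr_ge0 => i _; apply: sqr_ge0. Qed.

Lemma sqn_eq0 (F : realType) N (z : 'rV[F]_N) : sqn z = 0 -> z = 0.
Proof.
move=> /eqP; rewrite psumr_eq0 => [/allP z0|i _]; last exact: sqr_ge0.
apply/rowP => i; rewrite mxE; apply/eqP; rewrite -sqrf_eq0.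
by apply: z0; rewrite mem_index_enum.
Qed.

Lemma sqnZ (F : realType) N c (z : 'rV[F]_N) : sqn (c *: z) = c ^+ 2 * sqn z.
Proof. by rewrite /sqn mulr_sumr; apply: eq_bigr => i _; rewrite mxE exprMn. Qed.

Lemma sqn_delta (F : realType) N (i : 'I_N) :
  sqn (delta_mx ord0 i : 'rV[F]_N) = 1.
Proof.
rewrite /sqn (bigD1 i) //= big1 => [|j ji]; rewrite !mxE ?eqxx ?expr1n ?addr0 //.
by rewrite (negPf ji) expr0n.
Qed.

Lemma sqn_coord (F : realType) n (z : 'rV[F]_(n + n)) :
  sqn z = \sum_(j < n) (xcoord j z ^+ 2 + ycoord j z ^+ 2).
Proof. by rewrite /sqn big_split_ord big_split. Qed.

Lemma bform_Jmx_le (F : realType) n (u w : 'rV[F]_(n + n)) :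
  `|bform (Jmx F n) u w| <= (sqn u + sqn w) / 2.
Proof.
rewrite bform_JmxE; apply: le_trans (ler_norm_sum _ _ _) _.
rewrite !sqn_coord -big_split /= mulr_suml; apply: ler_sum => j _.
set a := xcoord j u; set b := ycoord j u; set c := xcoord j w; set d := ycoord j w.
have := sqr_ge0 (a - d); have := sqr_ge0 (a + d).
have := sqr_ge0 (b - c); have := sqr_ge0 (b + c).
rewrite ler_norml => *; apply/andP; split; nra.
Qed.

Definition cylsq (F : realType) n k (z : 'rV[F]_(n + n)) : F :=
  \sum_(j < n | (j < k)%N) (xcoord j z ^+ 2 + ycoord j z ^+ 2).

(** By the parallelogram identity, the sum over [z] and [- z] of the squared
    norms of [A z + b] dominates twice that of [A z]; rescaling an arbitrary
    vector to norm [r] gives the general estimate. *)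
Lemma cylsq_contract (F : realType) n k (r R : F)
    (A : {linear 'rV[F]_(n + n) -> 'rV[F]_(n + n)}) (b : 'rV[F]_(n + n)) :
    0 < r ->
    (forall z, cball n r z -> cylinder n k R (A z + b)) ->
  forall z, r ^+ 2 * cylsq k (A z) <= R ^+ 2 * sqn z.
Proof.
move=> r0 sub.
have ball z : sqn z <= r ^+ 2 -> cylsq k (A z) <= R ^+ 2.
  move=> zr.
  have inball y : sqn y <= r ^+ 2 -> cball n r y.
    move=> yr; rewrite /cball /= /enorm.
    by rewrite -(ger0_norm (ltW r0)) -sqrtr_sqr ler_wsqrtr.
  have h1 := sub z (inball _ zr).
  have zr' : sqn (- z) <= r ^+ 2 by rewrite -scaleN1r sqnZ sqrrN expr1n mul1r.
  have h2 := sub (- z) (inball _ zr').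
  rewrite /cylinder /= in h1 h2.
  suff : 2 * cylsq k (A z) <= R ^+ 2 + R ^+ 2 by lra.
  apply: le_trans (lerD h1 h2); rewrite -big_split /= /cylsq mulr_sumr.
  apply: ler_sum => j _; rewrite /xcoord /ycoord linearN !mxE.
  set x := A z _ _; set y := A z _ _; set x' := b _ _; set y' := b _ _.
  by have := sqr_ge0 x'; have := sqr_ge0 y'; nra.
move=> z; have [z0|z0] := eqVneq (sqn z) 0.
  rewrite (sqn_eq0 z0) linear0 /cylsq big1 ?mulr0.
    by apply: mulr_ge0; [apply: sqr_ge0|apply: sqn_ge0].
  by move=> j _; rewrite /xcoord /ycoord !mxE expr0n addr0.
have zp : 0 < sqn z by rewrite lt_neqAle eq_sym z0 sqn_ge0.
pose c := r / Num.sqrt (sqn z).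
have c2 : c ^+ 2 = r ^+ 2 / sqn z by rewrite expr_div_n sqr_sqrtr // ltW.
have := ball (c *: z); rewrite sqnZ c2 divfK // => /(_ (lexx _)).
have -> : cylsq k (A (c *: z)) = c ^+ 2 * cylsq k (A z).
  rewrite /cylsq mulr_sumr; apply: eq_bigr => j _.
  by rewrite /xcoord /ycoord linearZ !mxE !exprMn mulrDr.
by rewrite c2 mulrAC ler_pdivrMr.
Qed.

Lemma geometric_lt (F : realType) (t C d : F) : 0 <= t < 1 -> 0 < d ->
  exists m, C * t ^+ m < d.
Proof.
move=> /andP[t0 t1] d0.
(* The right-hand side is 1 - t times the sum of the m powers of t below the
   m-th, each of them at least t ^+ m. *)
have bern m : m%:R * (1 - t) * t ^+ m <= 1 - t ^+ m.
  elim: m => [|m IHm]; first by rewrite !mul0r subrr.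
  have tm : t ^+ m <= 1 by rewrite exprn_ile1 // ltW.
  have tm0 : 0 <= t ^+ m by rewrite exprn_ge0.
  rewrite exprS -natr1; have txm : t * t ^+ m <= 1 by rewrite mulr_ile1 // ltW.
  have := ler_wpM2l t0 IHm.
  have : (1 - t) * (t * t ^+ m) <= 1 - t by rewrite ler_piMr // subr_ge0 ltW.
  by move: (t ^+ m) => x; lra.
have D0 : 0 < d * (1 - t) by rewrite mulr_gt0 // subr_gt0.
pose m := Num.bound (`|C| / (d * (1 - t))).
have mC : `|C| < m%:R * (d * (1 - t)).
  rewrite -ltr_pdivrMr //; apply: archi_boundP.
  by rewrite divr_ge0 // ltW.
exists m; have tm0 : 0 <= t ^+ m by rewrite exprn_ge0.
have le1 : C * t ^+ m <= m%:R * (d * (1 - t)) * t ^+ m.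
  by rewrite ler_wpM2r // (le_trans (ler_norm C)) // ltW.
have le2 : m%:R * (d * (1 - t)) * t ^+ m <= d * (1 - t ^+ m).
  by rewrite mulrCA -mulrA ler_wpM2l // ltW.
move: tm0; rewrite le_eqVlt => /predU1P[<-|tm0]; first by rewrite mulr0.
apply: le_lt_trans le1 (le_lt_trans le2 _).
by rewrite gtr_pMr // ltrBlDr ltrDl.
Qed.

(** * Linear squeezing *)

(** [M] represents the map on row vectors.  From [M J M^T = c J] one passes to
    [M^T J M = c J], which concerns the columns of [M]: applying the contraction
    estimate to the column of coordinate [x_1] produces its own squared norm in
    that coordinate, so this squared norm is at most [t]; likewise for [y_1]. *)
Lemma linear_squeezing_lt (F : realType) n k (t : F) (M : 'M[F]_(n + n)) :
    (0 < k < n)%N -> 0 <= t ->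
    (forall v, wedge_pow (omega F n) k (fun i => v i *m M) =
               wedge_pow (omega F n) k v) ->
    (forall z, cylsq k (z *m M) <= t * sqn z) ->
  1 <= t.
Proof.
move=> kn t0 MJ Mt.
pose J := Jmx F n; pose S' := M *m J *m M^T.
have JN : J^T = - J by exact: trmx_Jmx.
have S'N : S'^T = - S'.
  by rewrite !trmx_mul trmxK JN mulNmx mulmxN mulmxA.
have eqw : wedge_pow (form_of_mx J) k = wedge_pow (form_of_mx S') k.
  apply/funext => v; rewrite -omega_form_of_mx -MJ omega_form_of_mx.
  rewrite -[RHS]mul1r -[X in X * _](expr1n _ k); apply: wedge_pow_scale => f.
  by rewrite mul1r /form_of_mx /bform trmx_mul !mulmxA.
have [c ck SE] := darboux_frame_conformal JN S'N kn eqw (@std_frame_darboux F n).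
have c1 : `|c| = 1.
  by apply/eqP; rewrite -(@pexpr_eq1 _ _ k) // -?normrX ?ck ?normr1 //; lia.
have {SE}S'J : S' = c *: J.
  apply/matrixP => i j; rewrite [RHS]mxE -!bform_delta.
  by case: (split_ordP i) => i' ->; case: (split_ordP j) => j' ->;
    [apply: (SE i' j' false false)|apply: (SE i' j' false true)
    |apply: (SE i' j' true false)|apply: (SE i' j' true true)].
have c0 : c != 0 by rewrite -normr_eq0 c1 oner_eq0.
(* Since J *m J = - 1, the relation S' = c *: J exhibits a right inverse of M. *)
have Minv : M *m (J *m M^T *m (- c^-1 *: J)) = 1%:M.
  by rewrite !mulmxA -/S' S'J -scalemxAl -scalemxAr mulJJ scalerA mulrN divff //
    scaleN1r opprK.
have MtJ : M^T *m J *m M = c *: J.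
  have := mulmx1C Minv; rewrite -scalemxAr -scalemxAl.
  move=> /(congr1 (fun X => c *: (- J *m X))).
  rewrite -scalemxAr scalerA mulrN divff // scaleN1r mulmx1 scalerN => /oppr_inj <-.
  by rewrite mulNmx !mulmxA mulJJ !mulNmx mul1mx opprK.
have n0 : (0 < n)%N by lia.
pose o := Ordinal n0; pose x := lshift n o; pose y := rshift n o.
pose a i : 'rV[F]_(n + n) := row i M^T.
have aa i : (a i *m M) ord0 i = sqn (a i).
  by rewrite mxE; apply: eq_bigr => j _; rewrite !mxE expr2.
have at_le i : (i == x) || (i == y) -> sqn (a i) <= t.
  move=> ixy; have := Mt (a i).
  have : sqn (a i) ^+ 2 <= cylsq k (a i *m M).
    rewrite -aa /cylsq (bigD1 o) //=; last by lia.
    rewrite ler_wpDr //; first by apply: sumr_ge0 => j _; rewrite addr_ge0 ?sqr_ge0.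
    by case/orP: ixy => /eqP ->; rewrite /xcoord /ycoord ?lerDl ?lerDr sqr_ge0.
  move=> h1 h2; have := le_trans h1 h2.
  have := sqn_ge0 (a i); rewrite le_eqVlt => /predU1P[<- //|s0].
  by rewrite expr2 ler_pM2r.
have := bform_Jmx_le (a x) (a y).
have -> : bform (Jmx F n) (a x) (a y) = c.
  transitivity (bform (M^T *m J *m M) (delta_mx ord0 x) (delta_mx ord0 y)).
    by rewrite /bform /a !rowE trmx_mul trmxK !mulmxA.
  by rewrite bform_delta MtJ mxE /J /Jmx block_mxEur mxE eqxx mulr1.
rewrite c1; have := at_le x; have := at_le y; rewrite !eqxx orbT /=.
move=> /(_ isT) ? /(_ isT) ? ?; lra.
Qed.

(** For [t < 1] the iterates of [A] tend to 0, which contradicts the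
    invariance of the positive number [w ^ n (e_1, f_1, .., e_n, f_n)]. *)
Lemma linear_squeezing_eq (F : realType) n (t : F)
    (A : 'rV[F]_(n + n) -> 'rV[F]_(n + n)) :
    (0 < n)%N ->
    (forall v, wedge_pow (omega F n) n (fun i => A (v i)) =
               wedge_pow (omega F n) n v) ->
    0 <= t -> (forall z, cylsq n (A z) <= t * sqn z) ->
  1 <= t.
Proof.
move=> n0 Aw t0 At; rewrite leNgt; apply/negP => t1.
have sqA z : sqn (A z) <= t * sqn z.
  rewrite sqn_coord; apply: le_trans (At z); rewrite /cylsq.
  by rewrite [leRHS](eq_bigl xpredT) // => j; rewrite ltn_ord.
have sqAm m z : sqn (iter m A z) <= t ^+ m * sqn z.
  elim: m => [|m IHm] /=; first by rewrite mul1r.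
  by apply: le_trans (sqA _) _; rewrite exprS -mulrA ler_wpM2l.
have wAm m v : wedge_pow (omega F n) n (fun i => iter m A (v i)) =
    wedge_pow (omega F n) n v.
  by elim: m => //= m IHm; rewrite Aw.
have := wedge_pow_darboux_frame_gt0 (@std_frame_darboux F n).
rewrite -omega_form_of_mx.
set v := darboux_frame_tuple _ => d0.
have [C C0 bound] := wedge_pow_bound (omega F n) n.
have [m] := geometric_lt C (introT andP (conj t0 t1)) d0.
apply/negP; rewrite -leNgt -(wAm m).
have tm0 : 0 <= t ^+ m by rewrite exprn_ge0.
have tm1 : t ^+ m <= 1 by rewrite exprn_ile1 // ltW.
apply: le_trans (ler_norm _) _.
apply: le_trans (bound (t ^+ m) _ tm0 _) _; last first.
  by rewrite ler_wpM2l // ler_iXnr.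
move=> f; rewrite omega_form_of_mx /form_of_mx.
apply: le_trans (bform_Jmx_le _ _) _.
have sq1 i : sqn (iter m A (v i)) <= t ^+ m.
  by apply: le_trans (sqAm _ _) _; rewrite /v /darboux_frame_tuple sqn_delta mulr1.
have := sq1 (f ord0); have := sq1 (f ord_max); lra.
Qed.

Theorem theorem3p7 (F : realType) (n k : nat) (r R : F)
  (hk1 : (1 <= k)%N) (hkn : (k <= n)%N) (hr : 0 < r) (hR : 0 < R)
  (A : {linear 'rV[F]_(n + n) -> 'rV[F]_(n + n)}) (b : 'rV[F]_(n + n))
  (Psi : 'rV[F]_(n + n) -> 'rV[F]_(n + n))
  (hPsi : forall z, Psi z = A z + b)
  (hA : pullback A (wedge_pow (omega F n) k) = wedge_pow (omega F n) k)
  (hsub : Psi @` cball n r `<=` cylinder n k R) :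
  r <= R.
Proof.
have sub z : cball n r z -> cylinder n k R (A z + b).
  by move=> zr; apply: hsub; exists z.
have r2 : 0 < r ^+ 2 by rewrite exprn_gt0.
have contract z : cylsq k (A z) <= (R ^+ 2 / r ^+ 2) * sqn z.
  by rewrite mulrAC ler_pdivlMr // mulrC; apply: cylsq_contract sub z.
have pres v : wedge_pow (omega F n) k (fun i => A (v i)) =
    wedge_pow (omega F n) k v by rewrite -[in RHS]hA.
suff : 1 <= R ^+ 2 / r ^+ 2.
  by rewrite ler_pdivlMr // mul1r (ler_sqr (ltW hr) (ltW hR)).
have t0 : 0 <= R ^+ 2 / r ^+ 2 by rewrite divr_ge0 ?sqr_ge0.
move: hkn; rewrite leq_eqVlt => /predU1P[kn|kn].
- by subst k; apply: linear_squeezing_eq pres t0 contract.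
- apply: (@linear_squeezing_lt _ n k _ (lin1_mx A)) => //.
  + by rewrite hk1.
  + move=> v; rewrite -[RHS]pres; congr (wedge_pow _ _ _).
    by apply/funext => i; rewrite mul_rV_lin1.
  + by move=> z; rewrite mul_rV_lin1.
Qed.
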